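(* Let $0<\alpha<1$, $a<b$, let $H:\mathbb{R}^2\to\mathbb{R}$, $(x,p)\mapsto H(x,p)$, be a Hamiltonian function and let $L_H(x,p,v,w)=pv-H(x,p)$. Then the solutions $(x(t),p(t))$ of the fractional system $${}_a\mathcal{D}_t^\alpha x(t)=\partial_2H(x(t),p(t)),\qquad {}_a\mathcal{D}_t^\alpha p(t)=-\partial_1H(x(t),p(t))$$ coincide with the causal critical points of the action $$\mathcal{A}(\mathcal{E}_\alpha(L_H))(x,p)=\int_a^b L_H\big(x(t),p(t),{}_a\mathcal{D}_t^\alpha x(t),{}_a\mathcal{D}_t^\alpha p(t)\big)\,dt .$$ More precisely, the following two procedures starting from $L_H$ yield the same fractional system (the one displayed above): (1) apply the classical least action principle to $L_H$, which gives the canonical equations $\frac{d}{dt}x(t)=\partial_2H(x(t),p(t))$, $\frac{d}{dt}p(t)=-\partial_1H(x(t),p(t))$, and then take the fractional embedding $\mathcal{E}_\alpha$ of these equations; (2) take the fractional embedding $\mathcal{E}_\alpha(L_H)$ of $L_H$ and then apply the causal fractional least action principle, i.e. form the causal fractional Euler-Lagrange equation of $L_H$.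
   Context: $\partial_i$ denotes the partial derivative with respect to the $i$-th argument. The left Caputo derivative is $${}_a\mathcal{D}_t^\alpha f(t)=\frac{1}{\Gamma(1-\alpha)}\int_a^t (t-\tau)^{-\alpha}f'(\tau)\,d\tau .$$ Fractional embedding of operators: for tuples of smooth functions $\mathbf f=(f_i)$, $\mathbf g=(g_i)$, the differential operator $$\mathcal{O}(\mathbf f,\mathbf g)(y)(t)=\sum_{i}\Big(f_i\cdot\frac{d^i}{dt^i}g_i\Big)\Big(y(t),\dots,\frac{d^k}{dt^k}y(t),t\Big)$$ (componentwise products) has fractional embedding $$\mathcal{E}_\alpha(\mathcal{O}(\mathbf f,\mathbf g))(y)(t)=\sum_{i}\big(f_i\cdot({}_a\mathcal{D}_t^\alpha)^i g_i\big)\big(y(t),\dots,({}_a\mathcal{D}_t^\alpha)^k y(t),t\big),$$ i.e. every $\frac{d}{dt}$ is replaced by ${}_a\mathcal{D}_t^\alpha$; the embedding of the equation $\mathcal{O}(\mathbf f,\mathbf g)(y)=0$ is $\mathcal{E}_\alpha(\mathcal{O}(\mathbf f,\mathbf g))(y)=0$. A Lagrangian $L$ is identified with the operator $y\mapsto L(y(t),\frac{d}{dt}y(t),t)$, so $\mathcal{E}_\alpha(L)(y)(t)=L(y(t),{}_a\mathcal{D}_t^\alpha y(t),t)$. Here $y=(x,p)$ is the configuration variable and $(v,w)$ the corresponding velocity variable. The classical least action principle gives the Euler-Lagrange equation $\partial_1L(y,\frac{d}{dt}y,t)-\frac{d}{dt}\partial_2L(y,\frac{d}{dt}y,t)=0$.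 The causal fractional Euler-Lagrange equation associated with $L$ is $$\partial_1 L\big(y(t),{}_a\mathcal{D}_t^\alpha y(t),t\big)-{}_a\mathcal{D}_t^\alpha\,\partial_2 L\big(y(t),{}_a\mathcal{D}_t^\alpha y(t),t\big)=0 ,$$ where $\partial_1,\partial_2$ are the (vector) partial derivatives with respect to configuration and velocity. For $L_H$ this means $\frac{\partial L_H}{\partial x}-{}_a\mathcal{D}_t^\alpha\frac{\partial L_H}{\partial v}=0$ and $\frac{\partial L_H}{\partial p}-{}_a\mathcal{D}_t^\alpha\frac{\partial L_H}{\partial w}=0$, evaluated at $(x(t),p(t),{}_a\mathcal{D}_t^\alpha x(t),{}_a\mathcal{D}_t^\alpha p(t))$. A causal critical point of $\mathcal{A}(\mathcal{E}_\alpha(L_H))$ is a pair $(x(t),p(t))$ satisfying this causal fractional Euler-Lagrange equation. *)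

(* Defs.v *)
From HB Require Import structures.
From mathcomp Require Import all_boot all_order all_algebra.
From mathcomp Require Import all_classical all_reals all_analysis.

Set Implicit Arguments.
Unset Strict Implicit.
Unset Printing Implicit Defensive.

Import Order.TTheory GRing.Theory Num.Theory.
Import numFieldNormedType.Exports.
Local Open Scope classical_set_scope.
Local Open Scope ring_scope.

Section CaputoDerivative.
Context {R : realType}.
Local Notation mu := (@lebesgue_measure R).

(* Meaningful for 0 < z, where the integral converges. *)
Definition Gamma (z : R) : R :=
  \int[mu]_(s in `]0, +oo[) (s `^ (z - 1) * expR (- s)).

(* Total: [derive1 f] and the integral take default values where they are
   undefined. For 0 < alpha < 1 and f absolutely continuous on [a, b], the
   defining integral converges for almost every t in [a, b]. *)
Definition caputo (alpha a : R) (f : R -> R) (t : R) : R :=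
  (Gamma (1 - alpha))^-1 *
    \int[mu]_(tau in `[a, t]) ((t - tau) `^ (- alpha) * derive1 f tau).

Definition absolutely_continuous (a b : R) (f : R -> R) : Prop :=
  forall e : R, 0 < e -> exists2 d : R, 0 < d &
    forall (n : nat) (u v : 'I_n -> R),
      (forall i, [/\ a <= u i, u i <= v i & v i <= b]) ->
      (forall i j, i != j -> `]u i, v i[ `&` `]u j, v j[ = set0) ->
      \sum_i (v i - u i) < d -> \sum_i `|f (v i) - f (u i)| < e.

End CaputoDerivative.

(* In this section [D] is a differentiation operator on scalar functions of
   time: [D := @derive1 R R] gives the classical notions, and
   [D := caputo alpha a] their fractional embeddings. *)
Section Embedding.
Context {R : realType}.
Variable D : (R -> R) -> R -> R.

Definition coordwise (n : nat) (y : R -> 'rV[R]_n) (t : R) : 'rV[R]_n :=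
  \row_j D (fun s => y s 0 j) t.

(* (y(t), D y(t), ..., D^k y(t)) *)
Definition jet (n k : nat) (y : R -> 'rV[R]_n) (t : R) : 'I_k.+1 -> 'rV[R]_n :=
  fun l => iter l (@coordwise n) y t.

(* sum_(i < N) f_i . D^i g_i along the jet of order k of y, where D^i acts on
   the function of time obtained by composing g_i with the jet. *)
Definition diff_operator (n m k N : nat)
    (f g : 'I_N -> ('I_k.+1 -> 'rV[R]_n) -> R -> 'rV[R]_m)
    (y : R -> 'rV[R]_n) (t : R) : 'rV[R]_m :=
  \sum_(i < N) map2_mx *%R (f i (jet y t) t)
    (iter i (@coordwise m) (fun s => g i (jet y s) s) t).

(* [along D L y] is the operator identified with the Lagrangian L. *)
Definition along (n : nat) (T : Type) (F : 'rV[R]_n -> 'rV[R]_n -> R -> T)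
    (y : R -> 'rV[R]_n) (t : R) : T :=
  F (y t) (coordwise y t) t.

Definition partial (n : nat) (F : 'rV[R]_n -> R) (j : 'I_n) (z : 'rV[R]_n) : R :=
  'D_(delta_mx 0 j) F z.

Definition grad_configuration (n : nat) (L : 'rV[R]_n -> 'rV[R]_n -> R -> R)
    (z v : 'rV[R]_n) (t : R) : 'rV[R]_n :=
  \row_j partial (fun z' => L z' v t) j z.

Definition grad_velocity (n : nat) (L : 'rV[R]_n -> 'rV[R]_n -> R -> R)
    (z v : 'rV[R]_n) (t : R) : 'rV[R]_n :=
  \row_j partial (fun v' => L z v' t) j v.

Definition euler_lagrange (n : nat) (L : 'rV[R]_n -> 'rV[R]_n -> R -> R)
    (y : R -> 'rV[R]_n) (t : R) : 'rV[R]_n :=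
  along (grad_configuration L) y t - coordwise (along (grad_velocity L) y) t.

End Embedding.

Section FractionalVariational.
Context {R : realType}.
Local Notation mu := (@lebesgue_measure R).

Definition fractional_action (alpha a b : R) (n : nat)
    (L : 'rV[R]_n -> 'rV[R]_n -> R -> R) (y : R -> 'rV[R]_n) : R :=
  \int[mu]_(t in `[a, b]) along (caputo alpha a) L y t.

(* Causal critical points of [fractional_action alpha a b L]. *)
Definition causal_critical_point (alpha a b : R) (n : nat)
    (L : 'rV[R]_n -> 'rV[R]_n -> R -> R) (y : R -> 'rV[R]_n) : Prop :=
  (forall j, absolutely_continuous a b (fun t => y t 0 j)) /\
  {ae mu, forall t, t \in `[a, b] ->
    euler_lagrange (caputo alpha a) L y t = 0}.

End FractionalVariational.

(* A point (x, p) of the phase plane is the row vector z with z 0 0 = x and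
   z 0 1 = p. *)
Section Hamiltonian.
Context {R : realType}.

Definition phase_point (x p : R) : 'rV[R]_2 :=
  \row_i (if i == 0 then x else p).

Definition phase_curve (x p : R -> R) (t : R) : 'rV[R]_2 :=
  phase_point (x t) (p t).

Variable H : 'rV[R]_2 -> R.

Definition d1 (x p : R) : R := partial H 0 (phase_point x p).
Definition d2 (x p : R) : R := partial H 1 (phase_point x p).

Definition hamiltonian_lagrangian (z v : 'rV[R]_2) (t : R) : R :=
  z 0 1 * v 0 0 - H z.

(* Coefficients (f_i), (g_i), i < 2, of the operator
   (x, p) |-> (d/dt x - d2 H (x, p), d/dt p + d1 H (x, p)),
   whose vanishing is the system of canonical equations:
   f_0 = f_1 = (1, 1), g_0 = (- d2 H, d1 H), g_1 = (x, p). *)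
Definition canonical_f (i : 'I_2) (z : 'I_1 -> 'rV[R]_2) (t : R) : 'rV[R]_2 :=
  const_mx 1.

Definition canonical_g (i : 'I_2) (z : 'I_1 -> 'rV[R]_2) (t : R) : 'rV[R]_2 :=
  if i == 0 then phase_point (- partial H 1 (z 0)) (partial H 0 (z 0))
  else z 0.

End Hamiltonian.

(* Main.v *)
Require Import Defs.
From HB Require Import structures.
From mathcomp Require Import all_boot all_order all_algebra.
From mathcomp Require Import all_classical all_reals all_analysis.
Import Order.TTheory GRing.Theory Num.Theory.
Import numFieldNormedType.Exports.
Local Open Scope classical_set_scope.
Local Open Scope ring_scope.

(** The Lagrangian L_H (x, p, v, w) = p v - H (x, p) is affine in the velocity,
    with momentum p conjugate to x and momentum 0 conjugate to p:
      grad_configuration L_H = (- d1 H, v - d2 H),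
      grad_velocity L_H = (p, 0).
    Its Euler-Lagrange equation for a differentiation operator D is therefore
      - d1 H - D p = 0,    D x - d2 H - D 0 = 0.
    This computation never differentiates a product or a composite with
    respect to time: the only property of D that it uses is D 0 = 0. Neither
    the Leibniz rule nor the chain rule, which fail for the Caputo derivative,
    is involved, so the same argument covers D = d/dt and the Caputo
    derivative ([euler_lagrange_hamiltonian]). This is why fractional embedding
    commutes with the variational principle here. On the side of the
    equations, the operator encoding the canonical system is, by its very form,
    (D x - d2 H, D p + d1 H) for every D ([diff_operator_canonical]). The
    statement on critical points follows by using the pointwise equivalence
    for almost every t. *)

(** Coordinates are continuous linear forms, hence their own differential;
    [R^o] presents the field as a module over itself, as linearity requires. *)
Lemma is_derive_coord {R : realType} {n : nat} (i : 'I_n) (z v : 'rV[R]_n) :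
  is_derive z v (fun w : 'rV[R]_n => w 0 i) (v 0 i).
Proof.
have lin : linear (fun w : 'rV[R]_n => w 0 i : R^o).
  by move=> c u w; rewrite !mxE.
pose entry : {linear 'rV[R]_n -> R^o} := HB.pack
  (fun w : 'rV[R]_n => w 0 i : R^o) (GRing.isLinear.Build _ _ _ _ _ lin).
apply: DeriveDef; first exact/diff_derivable/differentiable_coord.
rewrite deriveE; last exact: differentiable_coord.
by rewrite (@diff_lin R _ _ entry z) //; exact: coord_continuous.
Qed.

Lemma is_derive_scaled_coord {R : realType} {n : nat} (c : R) (i j : 'I_n)
    (z : 'rV[R]_n) :
  is_derive z (delta_mx 0 j) (c \*: (fun w : 'rV[R]_n => w 0 i))
    (c * (i == j)%:R).
Proof.
apply: is_derive_eq; first exact/is_deriveZ/is_derive_coord.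
by rewrite mxE eqxx.
Qed.

Lemma phase_point_eq0 {R : realType} (u v : R) :
  phase_point u v = 0 <-> u = 0 /\ v = 0.
Proof.
split=> [/rowP uv0|[-> ->]]; last by apply/rowP => j; rewrite !mxE if_same.
by have := uv0 0; have := uv0 1; rewrite !mxE.
Qed.

Lemma phase_point_eta {R : realType} (z : 'rV[R]_2) :
  z = phase_point (z 0 0) (z 0 1).
Proof.
apply/rowP; case=> [[|[|//]]] lt; rewrite !mxE; congr (z _ _); exact: val_inj.
Qed.

Lemma coordwise_phase_curve {R : realType} (D : (R -> R) -> R -> R)
    (x p : R -> R) (t : R) :
  coordwise D (phase_curve x p) t = phase_point (D x t) (D p t).
Proof.
rewrite (phase_point_eta (coordwise _ _ _)) !mxE.
by congr (phase_point (D _ t) (D _ t)); apply/funext => s; rewrite mxE.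
Qed.

Lemma grad_configuration_hamiltonian {R : realType} (H : 'rV[R]_2 -> R)
    (z v : 'rV[R]_2) (t : R) :
  differentiable H z ->
  grad_configuration (hamiltonian_lagrangian H) z v t =
    phase_point (- partial H 0 z) (v 0 0 - partial H 1 z).
Proof.
move=> dH; have LE : (fun w => hamiltonian_lagrangian H w v t) =
    v 0 0 \*: (fun w : 'rV[R]_2 => w 0 1) - H.
  by apply/funext => w; rewrite /hamiltonian_lagrangian mulrC.
have partialL j : partial (fun w => hamiltonian_lagrangian H w v t) j z =
    v 0 0 * (1 == j)%:R - partial H j z.
  rewrite LE; have /derivableP dHj := diff_derivable (v := delta_mx 0 j) dH.
  by have [] := is_deriveB (is_derive_scaled_coord (v 0 0) 1 j z) dHj.
rewrite (phase_point_eta (grad_configuration _ _ _ _)) !mxE !partialL.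
by rewrite mulr0 mulr1 sub0r.
Qed.

(** At a fixed point of the phase plane the Lagrangian is affine in (v, w):
    its linear part is p v and - H (x, p) is its constant term. *)
Lemma grad_velocity_hamiltonian {R : realType} (H : 'rV[R]_2 -> R)
    (z v : 'rV[R]_2) (t : R) :
  grad_velocity (hamiltonian_lagrangian H) z v t = phase_point (z 0 1) 0.
Proof.
have LE : hamiltonian_lagrangian H z ^~ t =
    z 0 1 \*: (fun w : 'rV[R]_2 => w 0 0) - cst (H z).
  exact/funext.
have partialL j : partial (hamiltonian_lagrangian H z ^~ t) j v =
    z 0 1 * (0 == j)%:R.
  rewrite LE -[RHS]subr0.
  by have [] := is_deriveB (is_derive_scaled_coord (z 0 1) 0 j v)
    (is_derive_cst (H z) v (delta_mx 0 j)).
rewrite (phase_point_eta (grad_velocity _ _ _ _)) !mxE !partialL.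
by rewrite mulr0 mulr1.
Qed.

(** The first coordinate of the Euler-Lagrange equation is - d1 H - D p = 0.
    The second one is D x - d2 H - D 0 = 0, where 0 is the momentum conjugate
    to p along the whole curve: this is where [D0] is used. *)
Lemma euler_lagrange_hamiltonian {R : realType} (D : (R -> R) -> R -> R)
    (D0 : D (cst 0) =1 cst 0) (H : 'rV[R]_2 -> R) (x p : R -> R) (t : R) :
  differentiable H (phase_curve x p t) ->
  euler_lagrange D (hamiltonian_lagrangian H) (phase_curve x p) t = 0 <->
  D x t = d2 H (x t) (p t) /\ D p t = - d1 H (x t) (p t).
Proof.
move=> dH.
have gradvE : along D (grad_velocity (hamiltonian_lagrangian H))
    (phase_curve x p) = phase_curve p (cst 0).
  by apply/funext => s; rewrite /along grad_velocity_hamiltonian mxE.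
rewrite /euler_lagrange gradvE /along grad_configuration_hamiltonian //.
rewrite !coordwise_phase_curve D0 (phase_point_eta (_ - _)) !mxE /=.
rewrite phase_point_eq0 subr0 -/(d1 H _ _) -/(d2 H _ _).
split=> [[/subr0_eq <- /subr0_eq //]|[-> ->]].
by rewrite opprK addNr subrr.
Qed.

(** The operator is g_0 + D g_1 with g_0 = (- d2 H, d1 H) and g_1 = (x, p):
    [D] is applied to the coordinates of the curve and to nothing else, so the
    two coordinates of the operator are D x - d2 H and D p + d1 H. *)
Lemma diff_operator_canonical {R : realType} (D : (R -> R) -> R -> R)
    (H : 'rV[R]_2 -> R) (x p : R -> R) (t : R) :
  diff_operator D (@canonical_f R) (canonical_g H) (phase_curve x p) t = 0 <->
  D x t = d2 H (x t) (p t) /\ D p t = - d1 H (x t) (p t).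
Proof.
rewrite /diff_operator big_ord_recl big_ord1 /=.
rewrite /canonical_g /= -[fun s => _]/(phase_curve x p) coordwise_phase_curve.
rewrite (phase_point_eta (_ + _)) !mxE /= !mul1r phase_point_eq0.
rewrite -/(d1 H _ _) -/(d2 H _ _) addrC.
split=> [[/subr0_eq -> /eqP]|[-> ->]]; last by rewrite !subrr.
by rewrite addrC addr_eq0 => /eqP.
Qed.

Lemma derive1_0 {R : realType} : @derive1 R R (cst 0) = cst 0.
Proof. by apply/funext => t; exact: derive1_cst. Qed.

Lemma caputo_0 {R : realType} (alpha a : R) : caputo alpha a (cst 0) =1 cst 0.
Proof.
move=> t; rewrite /caputo derive1_0 (@eq_Rintegral _ _ _ _ _ (cst 0)).
  by rewrite /Rintegral integral0 mulr0.
by move=> tau _; rewrite mulr0.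
Qed.

Theorem theorem7 (R : realType) (alpha a b : R) (H : 'rV[R]_2 -> R)
    (alpha_gt0 : 0 < alpha) (alpha_lt1 : alpha < 1) (ab : a < b)
    (dH : forall z : 'rV[R]_2, differentiable H z) :
  (* the solutions of the fractional system are the causal critical points of
     the action, whose explicit form is recalled *)
  (forall x p : R -> R,
    fractional_action alpha a b (hamiltonian_lagrangian H) (phase_curve x p) =
      \int[@lebesgue_measure R]_(t in `[a, b])
        (p t * caputo alpha a x t - H (phase_point (x t) (p t))) /\
    ([/\ absolutely_continuous a b x, absolutely_continuous a b p &
       {ae @lebesgue_measure R, forall t, t \in `[a, b] ->
         caputo alpha a x t = d2 H (x t) (p t) /\
         caputo alpha a p t = - d1 H (x t) (p t)}] <->
     causal_critical_point alpha a b (hamiltonian_lagrangian H)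
       (phase_curve x p))) /\
  (forall (x p : R -> R) (t : R),
    [/\ (* (1) the classical Euler-Lagrange equation is the canonical system *)
        euler_lagrange (@derive1 R R) (hamiltonian_lagrangian H)
          (phase_curve x p) t = 0 <->
        derive1 x t = d2 H (x t) (p t) /\ derive1 p t = - d1 H (x t) (p t),
        (* which is the differential equation O(f, g)(x, p) = 0 *)
        diff_operator (@derive1 R R) (@canonical_f R) (canonical_g H)
          (phase_curve x p) t = 0 <->
        derive1 x t = d2 H (x t) (p t) /\ derive1 p t = - d1 H (x t) (p t),
        (* whose fractional embedding is the fractional system *)
        diff_operator (caputo alpha a) (@canonical_f R) (canonical_g H)
          (phase_curve x p) t = 0 <->
        caputo alpha a x t = d2 H (x t) (p t) /\
        caputo alpha a p t = - d1 H (x t) (p t)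
      & (* (2) the causal fractional Euler-Lagrange equation *)
        euler_lagrange (caputo alpha a) (hamiltonian_lagrangian H)
          (phase_curve x p) t = 0 <->
        caputo alpha a x t = d2 H (x t) (p t) /\
        caputo alpha a p t = - d1 H (x t) (p t)]).
Proof.
have EL x p t := euler_lagrange_hamiltonian (caputo alpha a)
  (caputo_0 alpha a) H x p t (dH _).
split=> x p => [|t]; last first.
  split; [|exact: diff_operator_canonical..|exact: EL].
  by apply: euler_lagrange_hamiltonian => // s; rewrite derive1_0.
split.
  apply: eq_Rintegral => t _.
  by rewrite /along /hamiltonian_lagrangian coordwise_phase_curve !mxE.
have coordE j : (fun t => phase_curve x p t 0 j) = if j == 0 then x else p.
  by apply/funext => t; rewrite mxE; case: (j == 0).
have aeF := ae_filter_ringOfSetsType (@lebesgue_measure R).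
split=> [[acx acp sol]|[ac crit]].
  split=> [j|]; first by rewrite coordE; case: (j == 0).
  by apply: (@filterS _ _ aeF _ _ _ sol) => t sol_t /sol_t /EL.
split; [by have := ac 0; rewrite coordE|by have := ac 1; rewrite coordE|].
by apply: (@filterS _ _ aeF _ _ _ crit) => t crit_t /crit_t /EL.
Qed.
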